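(* No finite group $G$ with $33\le|G|\le63$ admits diagonal double Kodaira structures (of any type $(b,n)$ with $b,n\ge2$).
   Context: Commutators are $[x,y]=xyx^{-1}y^{-1}$, and $o(x)$ is the order of $x$. Diagonal double Kodaira structures. Let $G$ be a finite group and $b,n\ge 2$ integers. A diagonal double Kodaira structure of type $(b,n)$ on $G$ is an ordered tuple $\mathfrak{S}=(\mathsf r_{11},\mathsf t_{11},\ldots,\mathsf r_{1b},\mathsf t_{1b},\mathsf r_{21},\mathsf t_{21},\ldots,\mathsf r_{2b},\mathsf t_{2b},\mathsf z)$ of $4b+1$ elements generating $G$, with $o(\mathsf z)=n$, such that the following relations hold for all $j,k\in\{1,\ldots,b\}$. Surface relations: $[\mathsf r_{1b}^{-1},\mathsf t_{1b}^{-1}]\,\mathsf t_{1b}^{-1}\,[\mathsf r_{1\,b-1}^{-1},\mathsf t_{1\,b-1}^{-1}]\,\mathsf t_{1\,b-1}^{-1}\cdots[\mathsf r_{11}^{-1},\mathsf t_{11}^{-1}]\,\mathsf t_{11}^{-1}\,(\mathsf t_{11}\mathsf t_{12}\cdots\mathsf t_{1b})=\mathsf z$; $[\mathsf r_{21}^{-1},\mathsf t_{21}]\,\mathsf t_{21}\,[\mathsf r_{22}^{-1},\mathsf t_{22}]\,\mathsf t_{22}\cdots[\mathsf r_{2b}^{-1},\mathsf t_{2b}]\,\mathsf t_{2b}\,(\mathsf t_{2b}^{-1}\mathsf t_{2\,b-1}^{-1}\cdots\mathsf t_{21}^{-1})=\mathsf z^{-1}$. Conjugacy action of $\mathsf r_{1j}$: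 $[\mathsf r_{1j},\mathsf r_{2k}]=1$ if $j<k$; $[\mathsf r_{1j},\mathsf r_{2j}]=1$; $[\mathsf r_{1j},\mathsf r_{2k}]=\mathsf z^{-1}\mathsf r_{2k}\mathsf r_{2j}^{-1}\mathsf z\,\mathsf r_{2j}\mathsf r_{2k}^{-1}$ if $j>k$; $[\mathsf r_{1j},\mathsf t_{2k}]=1$ if $j<k$; $[\mathsf r_{1j},\mathsf t_{2j}]=\mathsf z^{-1}$; $[\mathsf r_{1j},\mathsf t_{2k}]=[\mathsf z^{-1},\mathsf t_{2k}]$ if $j>k$; $[\mathsf r_{1j},\mathsf z]=[\mathsf r_{2j}^{-1},\mathsf z]$. Conjugacy action of $\mathsf t_{1j}$: $[\mathsf t_{1j},\mathsf r_{2k}]=1$ if $j<k$; $[\mathsf t_{1j},\mathsf r_{2j}]=\mathsf t_{2j}^{-1}\mathsf z\,\mathsf t_{2j}$; $[\mathsf t_{1j},\mathsf r_{2k}]=[\mathsf t_{2j}^{-1},\mathsf z]$ if $j>k$; $[\mathsf t_{1j},\mathsf t_{2k}]=1$ if $j<k$; $[\mathsf t_{1j},\mathsf t_{2j}]=[\mathsf t_{2j}^{-1},\mathsf z]$; $[\mathsf t_{1j},\mathsf t_{2k}]=\mathsf t_{2j}^{-1}\mathsf z\,\mathsf t_{2j}\mathsf z^{-1}\mathsf t_{2k}\mathsf z\,\mathsf t_{2j}^{-1}\mathsf z^{-1}\mathsf t_{2j}\mathsf t_{2k}^{-1}$ if $j>k$; $[\mathsf t_{1j},\mathsf z]=[\mathsf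 t_{2j}^{-1},\mathsf z]$. *)

(* Defs.v *)
From mathcomp Require Import all_boot all_fingroup.

Set Implicit Arguments.
Unset Strict Implicit.
Unset Printing Implicit Defensive.

Local Open Scope group_scope.

(* MathComp's [~ x, y] is x^-1 * y^-1 * x * y; the convention here is the
   other one, i.e. kcomm x y = [~ x^-1, y^-1]. *)
Definition kcomm (gT : finGroupType) (x y : gT) : gT := x * y * x^-1 * y^-1.

(* The 4b + 1 elements r_11, t_11, ..., r_1b, t_1b, r_21, t_21, ..., r_2b,
   t_2b, z. Indices are shifted by one: r_{1,j+1} is r1 j for j : 'I_b. *)
Record ddk_tuple (gT : finGroupType) (b : nat) := DdkTuple {
  r1 : 'I_b -> gT;
  t1 : 'I_b -> gT;
  r2 : 'I_b -> gT;
  t2 : 'I_b -> gT;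
  z : gT
}.

Section Relations.

Variables (gT : finGroupType) (b : nat) (S : ddk_tuple gT b).

Local Notation r1 := (r1 S).
Local Notation t1 := (t1 S).
Local Notation r2 := (r2 S).
Local Notation t2 := (t2 S).
Local Notation z := (z S).

Definition ddk_elements : {set gT} :=
  [set r1 j | j : 'I_b] :|: [set t1 j | j : 'I_b]
    :|: [set r2 j | j : 'I_b] :|: [set t2 j | j : 'I_b] :|: [set z].

(* \prod takes its factors in increasing order of the index, so the products
   with rev_ord j run over the indices b, b - 1, ..., 1. *)
Definition surface_relations : Prop :=
  (\prod_(j < b) (kcomm (r1 (rev_ord j))^-1 (t1 (rev_ord j))^-1
                    * (t1 (rev_ord j))^-1))
    * (\prod_(j < b) t1 j) = z
  /\
  (\prod_(j < b) (kcomm (r2 j)^-1 (t2 j) * t2 j))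
    * (\prod_(j < b) (t2 (rev_ord j))^-1) = z^-1.

Record action_r1_relations : Prop := {
  r1_r2_lt : forall j k : 'I_b, j < k -> kcomm (r1 j) (r2 k) = 1;
  r1_r2_eq : forall j : 'I_b, kcomm (r1 j) (r2 j) = 1;
  r1_r2_gt : forall j k : 'I_b, k < j ->
    kcomm (r1 j) (r2 k) = z^-1 * r2 k * (r2 j)^-1 * z * r2 j * (r2 k)^-1;
  r1_t2_lt : forall j k : 'I_b, j < k -> kcomm (r1 j) (t2 k) = 1;
  r1_t2_eq : forall j : 'I_b, kcomm (r1 j) (t2 j) = z^-1;
  r1_t2_gt : forall j k : 'I_b, k < j ->
    kcomm (r1 j) (t2 k) = kcomm z^-1 (t2 k);
  r1_z : forall j : 'I_b, kcomm (r1 j) z = kcomm (r2 j)^-1 z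
}.

Record action_t1_relations : Prop := {
  t1_r2_lt : forall j k : 'I_b, j < k -> kcomm (t1 j) (r2 k) = 1;
  t1_r2_eq : forall j : 'I_b, kcomm (t1 j) (r2 j) = (t2 j)^-1 * z * t2 j;
  t1_r2_gt : forall j k : 'I_b, k < j ->
    kcomm (t1 j) (r2 k) = kcomm (t2 j)^-1 z;
  t1_t2_lt : forall j k : 'I_b, j < k -> kcomm (t1 j) (t2 k) = 1;
  t1_t2_eq : forall j : 'I_b, kcomm (t1 j) (t2 j) = kcomm (t2 j)^-1 z;
  t1_t2_gt : forall j k : 'I_b, k < j ->
    kcomm (t1 j) (t2 k) =
      (t2 j)^-1 * z * t2 j * z^-1 * t2 k * z * (t2 j)^-1 * z^-1 * t2 j
        * (t2 k)^-1;
  t1_z : forall j : 'I_b, kcomm (t1 j) z = kcomm (t2 j)^-1 z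
}.

End Relations.

Record diagonal_double_kodaira_structure (gT : finGroupType) (G : {group gT})
    (b n : nat) (S : ddk_tuple gT b) : Prop := {
  ddk_b_ge2 : 2 <= b;
  ddk_n_ge2 : 2 <= n;
  ddk_gen : <<ddk_elements S>> = G;
  ddk_order_z : #[z S] = n;
  ddk_surface : surface_relations S;
  ddk_action_r1 : action_r1_relations S;
  ddk_action_t1 : action_t1_relations S
}.

Definition admits_ddks (gT : finGroupType) (G : {group gT}) (b n : nat) : Prop :=
  exists S : ddk_tuple gT b, diagonal_double_kodaira_structure G n S.

(* Main.v *)
Require Import Defs.
From mathcomp Require Import all_boot all_fingroup.
From mathcomp Require Import pgroup cyclic center commutator gseries nilpotent.
From mathcomp Require Import sylow abelian maximal integral_char zify.

(* Let A be generated by the r_{1j}^-1, t_{1j}^-1 and D by the r_{2j}, t_{2j};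
   they commute modulo the normal closure of z. Dividing out a maximal normal
   subgroup avoiding z turns this closure V into a minimal normal subgroup.
   - V is abelian: otherwise the quotient is simple of order 60, where the
     centralisers of nontrivial elements are abelian, so that commutation of
     nontrivial elements is transitive; the relations contradict this.
   - For X normalised by A and centralising V, with [D, X] contained in V, an
     element y of D moved by X has |V| conjugates under X, because the [y, l]
     with l in X form a nontrivial normal subgroup contained in V. Iterating
     over several y bounds the order of X from below.
   - If z is central, X = AV and four generators give |V|^5 dividing |G|, so
     32 divides |G| or 3^5 <= |G|. Otherwise X = [A, A] and three generators
     give |A| >= 2|V|^3, which forces |V| = 3 and G = A; then D lies in A, and
     an element of D acting on V by inversion has at most |V| conjugates under
     X, while its centraliser in X centralises D. *)

Set Implicit Arguments.
Unset Strict Implicit.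
Unset Printing Implicit Defensive.

Local Open Scope group_scope.

(** * Index-two subgroups and nonsolvable groups of order below 64 *)

Definition regular_sign (gT : finGroupType) (x : gT) : bool :=
  odd_perm (actperm 'R x).

Lemma regular_signM (gT : finGroupType) (x y : gT) :
  regular_sign (x * y) = regular_sign x (+) regular_sign y.
Proof. by rewrite /regular_sign morphM ?inE // odd_permM. Qed.

(** The cycles of right translation by [x] are the cosets [y *: <[x]>]. *)
Lemma regular_signE (gT : finGroupType) (x : gT) :
  regular_sign x = odd #|gT| (+) odd (#|gT| %/ #[x]).
Proof.
rewrite /regular_sign /odd_perm; congr (_ (+) odd _).
rewrite -cardsT (divgS (subsetT <[x]>)) -card_lcosets; congr #|pred_of_set _|.
have actX i y : (actperm 'R x ^+ i) y = y * x ^+ i.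
  by rewrite -morphX ?inE // actpermE.
have porbitE y : porbit (actperm 'R x) y = y *: <[x]>.
  apply/setP=> u; rewrite mem_lcoset.
  apply/porbitP/cycleP => [[i ->]|[i eq_u]]; exists i.
    by rewrite actX mulKg.
  by rewrite actX -eq_u mulKVg.
apply/setP=> B; apply/imsetP/lcosetsP => -[y _ ->]; exists y;
  by rewrite ?inE ?porbitE.
Qed.

(** The subgroup is the kernel of the sign of the regular representation: an involution acts by
    [#|G| / 2] transpositions, an odd number. *)
Lemma exists_index2 (gT : finGroupType) (G : {group gT}) :
  #|G| %% 4 = 2 -> exists2 H : {group gT}, H <| G & #|G : H| = 2.
Proof.
move=> G4; have cardT : #|{: subg_of G}| = #|G| by rewrite card_sub.
pose K := [set x : gT | (x \in G) && ~~ regular_sign (subg G x)].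
have gK : group_set K.
  apply/group_setP; split=> [|x y].
    by rewrite inE group1 morph1 regular_signE order1 divn1 addbb.
  rewrite !inE => /andP[Gx sx] /andP[Gy sy].
  by rewrite groupM // morphM // regular_signM (negbTE sx).
have G2 : 2 %| #|G| by move: #|G| G4 => m; lia.
have [x Gx ox] := Cauchy (isT : prime 2) G2.
have sx : regular_sign (subg G x).
  by rewrite regular_signE cardT order_injm ?injm_subg // ox; lia.
have sKG : K \subset G by apply/subsetP=> y; rewrite inE => /andP[].
have cGK : #|G :\: K| = #|K|.
  rewrite -(card_rcoset K x); congr #|pred_of_set _|; apply/setP=> y.
  rewrite mem_rcoset !inE groupMr ?groupV //.
  case Gy: (y \in G); rewrite ?andbF //= morphM ?groupV // regular_signM.
  by rewrite morphV // (regular_signE _^-1) orderV -regular_signE sx addbT andbT.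
have idx : #|G : Group gK| = 2.
  rewrite -divgS //= -(cardsID K G) (setIidPr sKG) cGK addnn -mul2n mulnK //.
  exact: (cardG_gt0 (Group gK)).
by exists (Group gK) => //; apply: index2_normal.
Qed.

(** By Burnside's theorem the order has three prime divisors, which leaves 30, 42 and 60. The first
    two are 2 modulo 4, and a subgroup of index two has order 15 or 21. *)
Lemma small_nonsolvable (gT : finGroupType) (G : {group gT}) :
  #|G| < 64 -> ~~ solvable G -> #|G| = 60.
Proof.
move=> leG nsolG.
have/negP : ~ size (primes #|G|) <= 2.
  by move/Burnside_p_a_q_b; apply/negP.
rewrite -ltnNge => pr3.
have : all (fun n => (2 < size (primes n)) ==> (n \in [:: 30; 42; 60])) (iota 0 64).
  by [].
move/allP/(_ #|G|); rewrite mem_iota leG pr3 !inE => /(_ isT).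
case/or3P=> /eqP // oG; case/negP: nsolG.
  all: have [|H nHG iH] := @exists_index2 _ G; first by rewrite oG.
  all: have := Lagrange (normal_sub nHG); rewrite iH oG => oH.
  all: rewrite (series_sol nHG); apply/andP; split; apply: Burnside_p_a_q_b;
    last by rewrite card_quotient ?normal_norm // iH.
have -> : #|H| = 15 by lia. 
by [].
have -> : #|H| = 21 by lia. 
by [].
Qed.

Lemma abelian_card_lt6 (gT : finGroupType) (G : {group gT}) :
  #|G| < 6 -> abelian G.
Proof.
have := cardG_gt0 G; case oG : #|G| => [|[|[|[|[|[|]]]]]] // _ _.
- by rewrite (card1_trivg oG) abelian1.
- by apply/cyclic_abelian/prime_cyclic; rewrite oG.
- by apply/cyclic_abelian/prime_cyclic; rewrite oG.
- by apply: (@card_p2group_abelian _ 2); rewrite ?oG.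
- by apply/cyclic_abelian/prime_cyclic; rewrite oG.
Qed.

(** In a nonabelian simple group no nontrivial class has prime power size, so the centraliser has
    order at most 6 or equal to 10. Its centre contains [x], so the central quotient has order 1, 2,
    3 or 5 and is cyclic. *)
Lemma simple60_cent1_abelian (gT : finGroupType) (G : {group gT}) (x : gT) :
  simple G -> #|G| = 60 -> x \in G -> x != 1 -> abelian 'C_G[x].
Proof.
move=> simG oG Gx ntx; have [abG|nabG] := boolP (abelian G).
  exact: abelianS (subsetIl _ _) abG.
have := primes_class_simple_gt1 simG nabG.
move=> /(_ (x ^: G)); rewrite !inE classG_eq1 ntx mem_classes // => /(_ isT).
rewrite -index_cent1.
set C := ('C_G[x])%G; have := Lagrange (subsetIl G 'C[x]); rewrite -/C oG.
set i := #|G : C| => oC pr_i.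
have le_i : i \in iota 0 61.
  rewrite mem_iota /= ltnS -oC leq_pmull ?cardG_gt0 //.
have : all (fun n => (1 < size (primes n)) && (60 %% n == 0) ==>
   (60 %/ n \in [:: 1; 2; 3; 4; 5; 6; 10]%N)) (iota 0 61) by [].
move/allP/(_ i le_i); rewrite pr_i.
have i0 : 0 < i by apply: indexg_gt0.
rewrite -oC modnMl mulnK //= => cardC.
apply: cyclic_center_factor_abelian.
have Zx : x \in 'Z(C).
  apply/centerP; split=> [|y]; first by rewrite in_setI Gx cent1id.
  by rewrite in_setI => /andP[_ /cent1P].
have : 1 < #|'Z(C)| by rewrite cardG_gt1; apply/trivgPn; exists x.
have := Lagrange (center_sub C).
rewrite -card_quotient ?normal_norm ?center_normal //.
set q := #|_ / _| => eqC Z1.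
have : q \in [:: 1; 2; 3; 5]%N.
  move: cardC; rewrite -eqC !inE; move: q #|'Z(C)| Z1 {eqC} => q m m1.
  have [q6 | q6 H] := ltnP q 6; last by exfalso; nia.
  by case: q q6 => [|[|[|[|[|[|q]]]]]] // _; lia.
rewrite !inE => /orP[/eqP/card1_trivg ->|pq]; first exact: cyclic1.
by apply: prime_cyclic; rewrite -/q; case/or3P: pq => /eqP->.
Qed.

(** * Commuting actions of [A] and [D] on an abelian minimal normal subgroup *)

Section CommutingActions.

Variables (gT : finGroupType) (A D V : {group gT}) (z : gT).
Hypotheses (abV : abelian V) (Vz : z \in V) (ntz : z != 1).
Hypotheses (minV : minnormal V (A <*> D)) (sDAV : [~: D, A] \subset V).

Let nVA : A \subset 'N(V).
Proof. by case/mingroupp/andP: minV => _; apply: subset_trans; apply: joing_subl. Qed.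

Let nVD : D \subset 'N(V).
Proof. by case/mingroupp/andP: minV => _; apply: subset_trans; apply: joing_subr. Qed.

Let sADV : [~: A, D] \subset V.
Proof. by rewrite commGC. Qed.

Let memJA v x : v \in V -> x \in A -> v ^ x \in V.
Proof. by move=> Vv Ax; rewrite memJ_norm // (subsetP nVA). Qed.

Let memJD v x : v \in V -> x \in D -> v ^ x \in V.
Proof. by move=> Vv Ax; rewrite memJ_norm // (subsetP nVD). Qed.

Let conjV u v : u \in V -> v \in V -> u ^ v = u.
Proof. by move=> Vu Vv; rewrite conjgE (centsP abV _ Vu _ Vv) mulKg. Qed.

(** [x] and [y] commute up to an element of [V], which acts trivially on the abelian [V]. *)
Lemma conj_swap v x y : v \in V -> x \in A -> y \in D -> (v ^ x) ^ y = (v ^ y) ^ x.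
Proof.
move=> Vv Ax Dy; rewrite -!conjgM (commgC x y) (conjgM v (y * x)).
apply: conjV; first by rewrite conjgM memJA ?memJD.
by apply: (subsetP sADV); apply: mem_commg.
Qed.

Lemma minnormal_eq (W : {group gT}) :
  W \subset V -> A \subset 'N(W) -> D \subset 'N(W) -> W :!=: 1 -> W :=: V.
Proof.
move=> sWV nWA nWD ntW; have [_ minW] := mingroupP minV.
by apply: minW => //; rewrite ntW join_subG nWA.
Qed.

(** By [conj_swap], moving [z ^ y] by a generator [x] of [A] amounts to moving [z ^ x], itself in
    the [D]-class of [z], by [y]. So [A] stabilises this class, and symmetrically. *)
Lemma class_orbit_eq (S T : {set gT}) :
    A :=: <<S>> -> D :=: <<T>> ->
    (forall x, x \in S -> exists2 y, y \in D & z ^ x = z ^ y) ->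
    (forall y, y \in T -> exists2 x, x \in A & z ^ y = z ^ x) ->
  z ^: A = z ^: D.
Proof.
move=> defA defD orbS orbT.
have nD : A \subset 'N(z ^: D).
  rewrite defA gen_subG; apply/subsetP=> x Sx; rewrite inE.
  have Ax : x \in A by rewrite defA mem_gen.
  apply/subsetP=> _ /imsetP[_ /imsetP[y Dy ->] ->].
  rewrite -conj_swap //; have [y' Dy' ->] := orbS x Sx.
  by rewrite -conjgM memJ_class ?groupM.
have nA : D \subset 'N(z ^: A).
  rewrite defD gen_subG; apply/subsetP=> y Ty; rewrite inE.
  have Dy : y \in D by rewrite defD mem_gen.
  apply/subsetP=> _ /imsetP[_ /imsetP[x Ax ->] ->].
  rewrite conj_swap //; have [x' Ax' ->] := orbT y Ty.
  by rewrite -conjgM memJ_class ?groupM.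
apply/eqP; rewrite eqEsubset; apply/andP; split; apply/subsetP=> _ /imsetP[x Ax ->].
  by rewrite memJ_norm ?class_refl // (subsetP nD).
by rewrite memJ_norm ?class_refl // (subsetP nA).
Qed.

Hypothesis orb : z ^: A = z ^: D.

Lemma gen_class : <<z ^: A>> = V.
Proof.
apply: minnormal_eq.
- rewrite gen_subG; apply/subsetP=> _ /imsetP[x Ax ->]; exact: memJA.
- by rewrite norms_gen ?class_norm.
- by rewrite orb norms_gen ?class_norm.
- by apply/trivgPn; exists z => //; rewrite mem_gen ?class_refl.
Qed.

Lemma cent_fixA x : x \in A -> z ^ x = z -> x \in 'C(V).
Proof.
move=> Ax fixz; rewrite -sub_cent1 -gen_class orb gen_subG.
apply/subsetP=> _ /imsetP[y Dy ->]; apply/cent1P/commgP/conjg_fixP.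
by rewrite -conj_swap // fixz.
Qed.

Hypothesis sVG : V \subset A <*> D.

(* If A / C_A(V) is nonabelian, then it has order at least 6 and acts freely on
   the orbit of z, so |V| >= 7; this gives |A <*> D| >= 7 * 6 * 2 unless A <*> D =
   C(V) A, in which case D acts on V through the centre. *)
Lemma der1_cent : #|A <*> D| < 84 -> A^`(1) \subset 'C(V).
Proof.
move=> leG; set G := A <*> D in leG; pose C := 'C_G(V)%G.
have sAG : A \subset G := joing_subl A D.
have nCG : C <| G.
  by rewrite /normal subsetIl normsI ?normG ?norms_cent // join_subG nVA.
(* By [cent_fixA], the stabiliser of [z] in [A] is the kernel of the action on [V]. *)
have idxA : #|A : C| = #|z ^: A|.
  rewrite -indexgI -index_cent1 /=.
  suff -> : A :&: 'C_G(V) = 'C_A[z] by [].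
  rewrite setIA (setIidPl sAG); apply/setP=> x; rewrite !in_setI.
  case Ax: (x \in A) => //=; apply/idP/cent1P=> [/centP cVx|czx].
    exact: cVx.
  by apply: cent_fixA => //; apply/conjg_fixP/commgP/commute_sym.
have [abAC|nabAC] := boolP (abelian (A / C)).
  have nCA := subset_trans sAG (normal_norm nCG).
  exact: subset_trans (der1_min nCA abAC) (subsetIr _ _).
have cls6 : 5 < #|z ^: A|.
  rewrite -idxA -card_quotient ?(subset_trans sAG) ?normal_norm // ltnNge.
  by apply: contra nabAC; apply: abelian_card_lt6.
have V7 : 6 < #|V|.
  rewrite (cardsD1 1) group1 ltnS (leq_trans cls6) ?subset_leq_card //.
  apply/subsetP=> _ /imsetP[x Ax ->].
  by rewrite !inE conjg_eq1 ntz memJA.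
have C7 : 6 < #|C|.
  by rewrite (leq_trans V7) ?subset_leq_card // subsetI sVG.
pose B := (C <*> A)%G.
have defB : B :=: C * A.
  exact: norm_joinEr (subset_trans sAG (normal_norm nCG)).
have sBG : B \subset G by rewrite join_subG sAG normal_sub.
have idxB : #|G : B| = 1%N.
  have := Lagrange sBG; have := Lagrange (joing_subl C A).
  have : #|B : C| = #|A : C| by rewrite defB indexMg.
  rewrite idxA => ->; have := indexg_gt0 G B.
  case: #|G : B| => [|[|m]] // _ oB oG.
  have := leq_mul (leq_mul C7 cls6) (isT : 1 < m.+2).
  by rewrite oB oG leqNgt leG.
have sGB : G \subset B by rewrite -indexg_eq1 idxB.
(* Now [y] acts on [V] as an element of [A], whose action commutes with that of [D]. Through the
   common orbit of [z], this carries over to [A] in [cAA]. *)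
have cDD v y y' : v \in V -> y \in D -> y' \in D -> (v ^ y) ^ y' = (v ^ y') ^ y.
  move=> Vv Dy Dy'; have: y \in C * A.
    by rewrite -defB (subsetP sGB) // (subsetP (joing_subr _ _)).
  case/mulsgP=> c x /setIP[_ /centP cVc] Ax ->.
  have fixV u : u \in V -> u ^ c = u.
    by move=> Vu; apply/conjg_fixP/commgP/commute_sym/cVc.
  by rewrite !(conjgM _ c) !fixV ?memJD // conj_swap.
have cAA x x' : x \in A -> x' \in A -> (z ^ x) ^ x' = (z ^ x') ^ x.
  move=> Ax Ax'.
  have [y Dy eqx] : exists2 y, y \in D & z ^ x = z ^ y.
    by apply/imsetP; rewrite -[_ @: _]orb memJ_class.
  have [y' Dy' eqx'] : exists2 y, y \in D & z ^ x' = z ^ y.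
    by apply/imsetP; rewrite -[_ @: _]orb memJ_class.
  by rewrite eqx eqx' -conj_swap // -[RHS]conj_swap // eqx eqx' cDD.
rewrite gen_subG; apply/subsetP=> _ /imset2P[x x' Ax Ax' ->].
apply: cent_fixA; first by rewrite groupR.
have := cAA _ _ (groupVr Ax) (groupVr Ax').
rewrite commgEl [x ^ x']conjgE !conjgM => ->.
by rewrite !conjgKV.
Qed.

(** * Chains of centralisers when the derived subgroup of [A] centralises [V] *)

Hypothesis der1A : A^`(1) \subset 'C(V).

Lemma fix_der1 v l : v \in V -> l \in A^`(1) -> v ^ l = v.
Proof.
move=> Vv /(subsetP der1A)/centP cl.
by apply/conjg_fixP/commgP/commute_sym/cl.
Qed.

(** [A] acts on [V] through an abelian group, so [x] and [y] agreeing on [z] agree on every [z ^ w],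
    and these generate [V]. *)
Lemma actD y : y \in D -> exists2 x, x \in A & forall v, v \in V -> v ^ y = v ^ x.
Proof.
move=> Dy; have [x Ax eqz] : exists2 x, x \in A & z ^ y = z ^ x.
  by apply/imsetP; rewrite -[_ @: _]/(z ^: A) orb memJ_class.
exists x => // v Vv; have : V \subset 'C[x * y^-1].
  rewrite -gen_class gen_subG; apply/subsetP=> _ /imsetP[w Aw ->].
  have swap_wx : (z ^ w) ^ x = (z ^ x) ^ w.
    rewrite -!conjgM (commgC w x) (conjgM z (x * w)).
    by rewrite fix_der1 ?mem_commg // memJA ?groupM.
  apply/cent1P/commgP/conjg_fixP; rewrite conjgM swap_wx.
  by rewrite -eqz -(conj_swap Vz Aw Dy) conjgK.
move/subsetP/(_ v Vv)/cent1P/commgP/conjg_fixP.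
by rewrite conjgM => /(canRL (conjgKV _)).
Qed.

Lemma norm_actD (W : {set gT}) :
  W \subset V -> A \subset 'N(W) -> D \subset 'N(W).
Proof.
move=> sWV nWA; apply/subsetP=> y Dy; have [x Ax eqx] := actD Dy.
rewrite inE; apply/subsetP=> _ /imsetP[w Ww ->].
by rewrite eqx ?(subsetP sWV) // memJ_norm // (subsetP nWA).
Qed.

(** The invariant of the descent: it makes [[~ y, l]] a morphism in [l] and passes from [X] to
    ['C_X[y]]. *)
Definition descends (X : {set gT}) : bool :=
  [&& X \subset 'C(V), A \subset 'N(X) & [~: D, X] \subset V].

(* [l |-> [~ y, l]] is a morphism from [X] to [V] whose image is normalised by
   [A], hence by [A <*> D], so that it is onto as soon as it is nontrivial. *)
Lemma card_cent1_moved (X : {group gT}) y l0 :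
    descends X -> y \in D -> l0 \in X -> y ^ l0 != y ->
  #|X| = (#|V| * #|'C_X[y]|)%N.
Proof.
case/and3P=> cVX nXA sDXV Dy Xl0 mvy.
have fixX v l : v \in V -> l \in X -> v ^ l = v.
  move=> Vv /(subsetP cVX)/centP cl.
  by apply/conjg_fixP/commgP/commute_sym/cl.
have VyX l : l \in X -> [~ y, l] \in V.
  by move=> Xl; apply/(subsetP sDXV)/mem_commg.
pose W := [set [~ y, l] | l in X].
have gW : group_set W.
  apply/group_setP; split=> [|_ _ /imsetP[l Xl ->] /imsetP[l' Xl' ->]].
    by apply/imsetP; exists 1; rewrite ?group1 ?commg1.
  apply/imsetP; exists (l' * l); rewrite ?groupM //.
  by rewrite commgMJ fixX // VyX.
have sWV : W \subset V by apply/subsetP=> _ /imsetP[l Xl ->]; apply: VyX.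
have nWA : A \subset 'N(W).
  apply/subsetP=> x Ax; rewrite inE.
  apply/subsetP=> _ /imsetP[_ /imsetP[l Xl ->] ->].
  have Xlx : l ^ x \in X by rewrite memJ_norm // (subsetP nXA).
  have Vyx : [~ y, x] \in V by apply/(subsetP sDAV)/mem_commg.
  apply/imsetP; exists (l ^ x) => //.
  (* [y ^ x] differs from [y] by an element of [V], which commutes with [l ^ x]. *)
  rewrite conjRg -{1}[y ^ x](mulKVg y) -commgEl commMgJ.
  have /conjg_fixP/eqP -> := fixX _ _ Vyx Xlx.
  by rewrite mulg1 (conjV (VyX _ Xlx) Vyx).
have ntW : W != 1.
  apply: contraNneq mvy => W1; apply/eqP/conjg_fixP.
  by rewrite -in_set1 -[[set 1]]W1; apply/imsetP; exists l0.
have defW : W = V := minnormal_eq (W := Group gW) sWV nWA (norm_actD sWV nWA) ntW.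
have -> : #|V| = #|y ^: X|.
  rewrite -(card_lcoset (y ^: X) y^-1) -defW; congr #|pred_of_set _|.
  apply/setP=> w; rewrite mem_lcoset invgK.
  apply/imsetP/imsetP=> -[l Xl eq_l]; exists l => //.
    by rewrite eq_l commgEl mulKVg.
  by rewrite commgEl -eq_l mulKg.
by rewrite -index_cent1 mulnC Lagrange ?subsetIl.
Qed.

(** [l ^ x] commutes with [y ^ x] and, centralising [V], with [[~ x, y]]; the product of these two
    is [y]. *)
Lemma descends_cent1 (X : {group gT}) y :
  descends X -> y \in D -> descends 'C_X[y].
Proof.
case/and3P=> cVX nXA sDXV Dy; apply/and3P; split.
- exact: subset_trans (subsetIl _ _) cVX.
- apply/subsetP=> x Ax; rewrite inE.
apply/subsetP=> _ /imsetP[l /setIP[Xl /cent1P cly] ->].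
have Xlx : l ^ x \in X by rewrite memJ_norm // (subsetP nXA).
rewrite inE Xlx /=; apply/cent1P.
have -> : y = y ^ x * [~ x, y].
  by rewrite commgEr conjVg mulKVg.
apply: commuteM; first by rewrite /commute -!conjMg cly.
have /centP := subsetP cVX _ Xlx; apply.
exact/(subsetP sADV)/mem_commg.
- exact: subset_trans (commgS D (subsetIl _ _)) sDXV.
Qed.

(** Comparing [y ^ (x * x')] with [y ^ (x' * x)] isolates the effect of the commutator. If
    [v ^ x != v], this commutator is an element of the derived subgroup moving [y]. *)
Lemma conj_commg y x x' u v :
    x \in A -> x' \in A -> u \in V -> v \in V ->
    y ^ x = u * y -> y ^ x' = v * y -> u ^ x' = u ->
  y ^ [~ x, x'] = (v ^ x)^-1 * v * y.
Proof.
move=> Ax Ax' Vu Vv yx yx' ux'; have Vvx : v ^ x \in V by apply: memJA.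
have e1 : y ^ (x * x') = v * u * y.
  by rewrite conjgM yx conjMg yx' ux' mulgA (centsP abV _ Vu _ Vv).
have e2 : y ^ (x' * x) = v ^ x * u * y by rewrite conjgM yx' conjMg yx mulgA.
have: y ^ (x * x') = v ^ x * u * y ^ [~ x, x'].
  rewrite (commgC x x') conjgM e2 conjMg.
  by rewrite (fix_der1 (groupM Vvx Vu) (mem_commg Ax Ax')).
rewrite e1 => /esym/(canRL (mulKg _)) ->.
rewrite invMg (centsP abV _ (groupVr Vu) _ (groupVr Vvx)).
by rewrite (centsP abV _ Vv _ Vu) -!mulgA mulKg.
Qed.

Lemma cent1_mem (X : {group gT}) l y :
  l \in X -> y ^ l = y -> l \in 'C_X[y].
Proof.
move=> Xl fix_y; rewrite inE Xl; apply/cent1P/commute_sym/commgP.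
exact/conjg_fixP.
Qed.

(** The pattern is triangular: each [x] moves the [y] of its own index and fixes the earlier ones,
    so it survives in the successive centralisers and yields a factor [#|V|]. The fifth factor is
    [V] itself, which [D] centralises because it acts on [V] as [A] does. *)
Lemma trivial_action_card y1 y2 y3 y4 x1 x2 x3 x4 :
    A \subset 'C(V) ->
    [&& y1 \in D, y2 \in D, y3 \in D & y4 \in D] ->
    [&& x1 \in A, x2 \in A, x3 \in A & x4 \in A] ->
    [&& y1 ^ x1 != y1, y2 ^ x2 != y2, y3 ^ x3 != y3 & y4 ^ x4 != y4] ->
    y1 ^ x2 = y1 -> y1 ^ x3 = y1 -> y1 ^ x4 = y1 ->
    y2 ^ x3 = y2 -> y2 ^ x4 = y2 -> y3 ^ x4 = y3 ->
  #|V| ^ 5 %| #|A <*> D|.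
Proof.
move=> cVA /and4P[Dy1 Dy2 Dy3 Dy4] /and4P[Ax1 Ax2 Ax3 Ax4].
case/and4P=> mv1 mv2 mv3 mv4 f12 f13 f14 f23 f24 f34.
pose X := (A <*> V)%G.
have defX : X :=: A * V by exact: norm_joinEl.
have cVX : X \subset 'C(V) by rewrite join_subG cVA.
have nXA : A \subset 'N(X) by rewrite (subset_trans (joing_subl A V)) ?normG.
have dX : descends X.
  rewrite /descends cVX nXA /=.
  rewrite gen_subG; apply/subsetP=> _ /imset2P[y l Dy + ->].
  rewrite defX => /mulsgP[x v Ax Vv ->]; rewrite commgMJ groupM //.
    by rewrite commgEr groupM // memJD ?groupV.
  by rewrite groupJ // (subsetP sDAV) ?mem_commg.
have sAX := subsetP (joing_subl A V).
pose X1 := ('C_X[y1])%G; pose X2 := ('C_X1[y2])%G; pose X3 := ('C_X2[y3])%G.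
have VD y : y \in D -> V \subset 'C[y].
  move=> Dy; apply/subsetP=> v Vv; apply/cent1P/commgP/conjg_fixP.
  have [x Ax ->] := actD Dy => //.
  by apply/conjg_fixP/commgP/commute_sym/(centP (subsetP cVA x Ax)).
have VX4 : V \subset 'C_X3[y4].
  by rewrite !subsetI !VD // joing_subr.
have dX1 : descends X1 := descends_cent1 dX Dy1.
have dX2 : descends X2 := descends_cent1 dX1 Dy2.
have dX3 : descends X3 := descends_cent1 dX2 Dy3.
have X1x x : x \in A -> y1 ^ x = y1 -> x \in X1.
  by move=> Ax; apply: cent1_mem (sAX _ Ax).
have X2x x : x \in A -> y1 ^ x = y1 -> y2 ^ x = y2 -> x \in X2.
  by move=> Ax f1; apply: cent1_mem (X1x _ Ax f1).
have X3x x : x \in A -> y1 ^ x = y1 -> y2 ^ x = y2 -> y3 ^ x = y3 -> x \in X3.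
  by move=> Ax f1 f2; apply: cent1_mem (X2x _ Ax f1 f2).
have c1 := card_cent1_moved dX Dy1 (sAX _ Ax1) mv1.
have c2 := card_cent1_moved dX1 Dy2 (X1x _ Ax2 f12) mv2.
have c3 := card_cent1_moved dX2 Dy3 (X2x _ Ax3 f13 f23) mv3.
have c4 := card_cent1_moved dX3 Dy4 (X3x _ Ax4 f14 f24 f34) mv4.
have sXG : X \subset A <*> D by rewrite join_subG sVG joing_subl.
apply: dvdn_trans (cardSg sXG); rewrite c1 c2 c3 c4 !expnS expn0 muln1.
by rewrite !dvdn_mul ?cardSg.
Qed.

(** The same triangular descent, run in the derived subgroup [L] of [A]. Here [x0] lies outside [L],
    and 1, [z], [z ^ x0] are distinct elements of [V]. *)
Lemma nontrivial_action_false x0 y1 y2 y3 h1 h2 h3 :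
    #|A <*> D| < 64 -> x0 \in A -> z ^ x0 != z ->
    [&& y1 \in D, y2 \in D & y3 \in D] ->
    [&& h1 \in A^`(1), h2 \in A^`(1) & h3 \in A^`(1)] ->
    [&& y1 ^ h1 != y1, y2 ^ h2 != y2 & y3 ^ h3 != y3] ->
    y1 ^ h2 = y1 -> y1 ^ h3 = y1 -> y2 ^ h3 = y2 ->
  False.
Proof.
move=> leG Ax0 mvz /and3P[Dy1 Dy2 Dy3] /and3P[Lh1 Lh2 Lh3].
case/and3P=> mv1 mv2 mv3 f12 f13 f23.
pose L := (A^`(1))%G.
have sLA : L \subset A := der_sub 1 A.
have nLA : A \subset 'N(L) := der_norm 1 A.
have sDLV : [~: D, L] \subset V := subset_trans (commgS D sLA) sDAV.
have dL : descends L by rewrite /descends der1A nLA.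
pose L1 := ('C_L[y1])%G; pose L2 := ('C_L1[y2])%G; pose L3 := ('C_L2[y3])%G.
have dL1 : descends L1 := descends_cent1 dL Dy1.
have dL2 : descends L2 := descends_cent1 dL1 Dy2.
have L1h h : h \in L -> y1 ^ h = y1 -> h \in L1 by apply: cent1_mem.
have L2h h : h \in L -> y1 ^ h = y1 -> y2 ^ h = y2 -> h \in L2.
  by move=> Lh f1; apply: cent1_mem (L1h _ Lh f1).
have c1 := card_cent1_moved dL Dy1 Lh1 mv1.
have c2 := card_cent1_moved dL1 Dy2 (L1h _ Lh2 f12) mv2.
have c3 := card_cent1_moved dL2 Dy3 (L2h _ Lh3 f13 f23) mv3.
have V3 : 3 <= #|V|.
  rewrite (cardsD1 1) group1 ltnS (cardsD1 z) !inE ntz Vz ltnS card_gt0.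
  by apply/set0Pn; exists (z ^ x0); rewrite !inE mvz conjg_eq1 ntz memJA.
have cardL : #|L| = (#|V| * (#|V| * (#|V| * #|L3|)))%N by rewrite c1 c2 c3.
have idxL : 1 < #|A : L|.
  rewrite indexg_gt1; apply: contra mvz => /subsetP/(_ _ Ax0) Lx0.
  by rewrite fix_der1.
have sAG : A \subset A <*> D := joing_subl A D.
have cardA := Lagrange sLA; have cardG := Lagrange sAG.
have L3gt := cardG_gt0 L3; have iG := indexg_gt0 (A <*> D) A.
(* The minimal product is [27 * 2 = 54]; increasing any of the three quantities brings it to at
   least 64. *)
have [cV cL3 iG1] : [/\ #|V| = 3, #|L3| = 1%N & #|A <*> D : A| = 1%N].
  move: leG; rewrite -cardG -cardA cardL.
  move: #|V| #|L3| #|_ : A| #|A : L| V3 L3gt iG idxL => v l i j v3 l0 i0 j1 lt64.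
  have bound v' l' i' : v' <= v -> l' <= l -> i' <= i ->
      v' * (v' * (v' * l')) * 2 * i' < 64.
    move=> lev lel lei; apply: leq_ltn_trans lt64.
    by rewrite leq_mul // leq_mul // !leq_mul.
  have v_eq : v = 3.
    by apply/eqP; rewrite eqn_leq v3 andbT leqNgt; apply/negP => /bound/(_ l0 i0).
  have l_eq : l = 1%N.
    by apply/eqP; rewrite eqn_leq l0 andbT leqNgt; apply/negP => /(bound _ _ _ v3)/(_ i0).
  split=> //; apply/eqP; rewrite eqn_leq i0 andbT leqNgt.
  by apply/negP => /(bound _ _ _ v3 l0).
have sDA : D \subset A.
  by apply: subset_trans (joing_subr A D) _; rewrite -indexg_eq1 iG1.
have [d Dd eq_d] : exists2 d, d \in D & z ^ x0 = z ^ d.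
  by apply/imsetP; rewrite -[_ @: _]/(z ^: D) -orb memJ_class.
(* As [V] has order 3, a nontrivial fixed point generates it, and [d] would fix [z]. *)
have fixV w : w \in V -> w ^ d = w -> w = 1.
  move=> Vw fix_w; apply: contraNeq mvz => ntw; rewrite eq_d.
  have ow : #[w] = 3.
    have : #[w] %| 3 by rewrite -cV order_dvdG.
    by rewrite dvdn_divisors // !inE order_eq1 (negbTE ntw) => /eqP.
  have defV : <[w]> = V.
    by apply/eqP; rewrite eqEcard cycle_subG Vw cV -orderE ow.
  by have := Vz; rewrite -defV => /cycleP[i ->]; rewrite conjXg fix_w.
(* If [l] commutes with [d], then [d] fixes [[~ y, l]], since [y ^ d] lies in [y] times [V]; so
   [[~ y, l]] is trivial by [fixV]. *)
have sCL3 : 'C_L[d] \subset L3.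
  apply/subsetP=> l /setIP[Ll /cent1P cld].
  have cl y : y \in D -> l \in 'C[y].
    move=> Dy; apply/cent1P/commute_sym/commgP/eqP; apply: fixV.
      exact/(subsetP sDLV)/mem_commg.
    have Vyd : [~ y, d] \in V by rewrite (subsetP sDAV) ?mem_commg ?(subsetP sDA).
    rewrite conjRg; have /commgP/conjg_fixP -> := cld.
    rewrite -{1}[y ^ d](mulKVg y) -commgEl commMgJ.
    have /conjg_fixP/eqP -> := fix_der1 Vyd Ll.
    by rewrite mulg1 conjV // (subsetP sDLV) ?mem_commg.
  by rewrite /= !in_setI Ll !cl.
have : #|L : 'C_L[d]| <= #|V|.
  rewrite index_cent1 -(card_lcoset V d); apply/subset_leq_card/subsetP.
  move=> _ /imsetP[l Ll ->]; rewrite mem_lcoset -commgEl.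
  by rewrite (subsetP sDLV) ?mem_commg.
have := Lagrange (subsetIl L 'C[d]); have := subset_leq_card sCL3.
rewrite cardL cV cL3 => le1 oL le3.
by have := leq_mul le1 le3; rewrite oL.
Qed.

End CommutingActions.

(** * Contradiction from a reduced set of relations *)

Lemma commg_gen_subset (gT : finGroupType) (S T : {set gT}) (Z : {group gT}) :
    <<S>> \subset 'N(Z) -> <<T>> \subset 'N(Z) ->
    (forall x y, x \in S -> y \in T -> [~ x, y] \in Z) ->
  [~: <<S>>, <<T>>] \subset Z.
Proof.
move=> nZS nZT cST; rewrite -quotient_cents2 //.
have nS := subset_trans (subset_gen S) nZS.
have nT := subset_trans (subset_gen T) nZT.
rewrite !quotient_gen // cent_gen gen_subG quotient_cents2 // gen_subG.
by apply/subsetP=> _ /imset2P[x y Sx Ty ->]; apply: cST.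
Qed.

(* The elements stand for r_{11}^-1, t_{11}^-1, r_{12}^-1, t_{12}^-1, r_{21},
   t_{21}, r_{22}, t_{22}, z: for [x] among the first four, [y ^ x] is the image
   of [y] under the conjugacy action of the structure. *)
Record action_core (gT : finGroupType) (a1 c1 a2 c2 d1 e1 d2 e2 z : gT) : Prop :=
  ActionCore {
    core_d1a1 : d1 ^ a1 = d1;
    core_d2a1 : d2 ^ a1 = d2;
    core_e2a1 : e2 ^ a1 = e2;
    core_d2c1 : d2 ^ c1 = d2;
    core_e2c1 : e2 ^ c1 = e2;
    core_d2a2 : d2 ^ a2 = d2;
    core_e1a1 : e1 ^ a1 = z^-1 * e1;
    core_e2a2 : e2 ^ a2 = z^-1 * e2;
    core_d1c1 : d1 ^ c1 = z ^ e1 * d1;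
    core_d2c2 : d2 ^ c2 = z ^ e2 * d2
  }.

Lemma morph_action_core (gT rT : finGroupType) (G : {group gT})
    (f : {morphism G >-> rT}) (a1 c1 a2 c2 d1 e1 d2 e2 z : gT) :
    [set a1; c1; a2; c2; d1; e1; d2; e2; z] \subset G ->
    action_core a1 c1 a2 c2 d1 e1 d2 e2 z ->
  action_core (f a1) (f c1) (f a2) (f c2) (f d1) (f e1) (f d2) (f e2) (f z).
Proof.
rewrite !subUset !sub1set -!andbA.
case/and5P=> Ga1 Gc1 Ga2 Gc2 /and5P[Gd1 Ge1 Gd2 Ge2 Gz].
case=> r1 r2 r3 r4 r5 r6 r7 r8 r9 r10; split.
all: by rewrite -?morphV -?morphJ -?morphM ?groupV ?groupJ //; congr (f _).
Qed.

Lemma mulg_neq (gT : finGroupType) (x y : gT) : x != 1 -> x * y != y.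
Proof. by apply: contraNneq => /(canRL (mulgK y)) ->; rewrite mulgV. Qed.

(** Nontrivial elements commute transitively: [a1] and [c1] commute through [d2], then [c1] and [d1]
    through [a1], whereas [c1] moves [d1]. *)
Lemma cent1_abelian_action_core_false (gT : finGroupType) (G : {group gT})
    (a1 c1 a2 c2 d1 e1 d2 e2 z : gT) :
    z != 1 -> [set a1; c1; d1; d2; e1] \subset G ->
    action_core a1 c1 a2 c2 d1 e1 d2 e2 z ->
    {in G, forall x, x != 1 -> abelian 'C_G[x]} ->
  False.
Proof.
move=> ntz; rewrite !subUset !sub1set -!andbA.
case/and5P=> Ga1 Gc1 Gd1 Gd2 Ge1 core abC.
have d1c1 : d1 ^ c1 != d1 by rewrite (core_d1c1 core) mulg_neq ?conjg_eq1.
have ntd2 : d2 != 1.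
  have : d2 ^ c2 != d2 by rewrite (core_d2c2 core) mulg_neq ?conjg_eq1.
  by apply: contraNneq => ->; rewrite conj1g.
have nta1 : a1 != 1.
  have : e1 ^ a1 != e1 by rewrite (core_e1a1 core) mulg_neq ?invg_eq1.
  by apply: contraNneq => ->; rewrite conjg1.
have memC x y : x \in G -> y ^ x = y -> x \in 'C_G[y].
  by move=> Gx fix_y; rewrite inE Gx; apply/cent1P/commute_sym/commgP/conjg_fixP.
have memC' x y : y \in G -> y ^ x = y -> y \in 'C_G[x].
  by move=> Gy fix_y; rewrite inE Gy; apply/cent1P/commgP/conjg_fixP.
have a1c1 : commute a1 c1.
  by apply: (centsP (abC d2 Gd2 ntd2)); apply: memC => //; case: core.
have c1a1 : c1 ^ a1 = c1 by apply/conjg_fixP/commgP/commute_sym.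
have : commute d1 c1.
  by apply: (centsP (abC a1 Ga1 nta1)); apply: memC' => //; case: core.
by move/commgP/conjg_fixP/eqP; apply/negP.
Qed.

Lemma minnormal_action_core_false (gT : finGroupType) (A D V : {group gT})
    (S T : {set gT}) (a1 c1 a2 c2 d1 e1 d2 e2 z : gT) :
    A :=: <<S>> -> D :=: <<T>> ->
    [set a1; c1; a2; c2] \subset A -> [set d1; e1; d2; e2] \subset D ->
    action_core a1 c1 a2 c2 d1 e1 d2 e2 z ->
    (forall x, x \in S -> exists2 y, y \in D & z ^ x = z ^ y) ->
    (forall y, y \in T -> exists2 x, x \in A & z ^ y = z ^ x) ->
    minnormal V (A <*> D) -> [~: D, A] \subset V -> z \in V -> z != 1 ->
    #|A <*> D| < 64 -> ~~ (32 %| #|A <*> D|) ->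
  False.
Proof.
move=> defA defD sA sD core conjS conjT minV sDAV Vz ntz leG n32.
have [Aa1 Ac1 Aa2 Ac2] : [/\ a1 \in A, c1 \in A, a2 \in A & c2 \in A].
  by move: sA; rewrite !subUset !sub1set -!andbA => /and4P.
have [Dd1 De1 Dd2 De2] : [/\ d1 \in D, e1 \in D, d2 \in D & e2 \in D].
  by move: sD; rewrite !subUset !sub1set -!andbA => /and4P.
have [sAG sDG] := (joing_subl A D, joing_subr A D).
have nVG : A <*> D \subset 'N(V) by case/mingroupp/andP: minV.
have Gz : z \in A <*> D.
  rewrite -groupV.
  have -> : z^-1 = e1 ^ a1 * e1^-1 by rewrite (core_e1a1 core) mulgK.
  by rewrite groupM ?groupV ?groupJ ?(subsetP sAG a1) ?(subsetP sDG e1).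
have sVG : V \subset A <*> D.
  apply/setIidPl; case/mingroupP: minV => _; apply; last exact: subsetIl.
  rewrite normsI ?normG // andbT; apply/trivgPn; exists z => //.
  by rewrite inE Vz.
have abV : abelian V.
  have [solV | nsolV] := boolP (solvable V).
    have [] := minnormal_solvable minV (subxx V) solV.
    by move=> _ _ /is_abelemP[p _ /abelem_abelian].
  have oV := small_nonsolvable (leq_ltn_trans (subset_leq_card sVG) leG) nsolV.
  (* A proper overgroup would have order at least 120. Being minimal normal in itself, [V] is then
     simple. *)
  have defV : V :=: A <*> D.
    apply/eqP; rewrite eqEcard sVG oV.
    have := cardSg sVG; rewrite oV => /dvdnP[k kE]; move: leG; rewrite kE.
    by case: k {kE} => [|[|k]] //; lia.
  have simV : simple V by move: minV; rewrite /simple -defV.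
  case: (cent1_abelian_action_core_false (G := V) ntz _ core).
    by rewrite defV !subUset !sub1set !(subsetP sAG a1, subsetP sAG c1,
      subsetP sDG d1, subsetP sDG d2, subsetP sDG e1).
  by move=> x Vx ntx; apply: simple60_cent1_abelian.
have orb : z ^: A = z ^: D
  by exact: (class_orbit_eq abV Vz minV sDAV defA defD conjS conjT).
have der1A : A^`(1) \subset 'C(V).
  by apply: (der1_cent abV Vz ntz minV sDAV orb sVG); apply: leq_trans leG _.
have d1c1 : d1 ^ c1 != d1 by rewrite (core_d1c1 core) mulg_neq ?conjg_eq1.
have d2c2 : d2 ^ c2 != d2 by rewrite (core_d2c2 core) mulg_neq ?conjg_eq1.
have e1a1 : e1 ^ a1 != e1 by rewrite (core_e1a1 core) mulg_neq ?invg_eq1.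
have e2a2 : e2 ^ a2 != e2 by rewrite (core_e2a2 core) mulg_neq ?invg_eq1.
have [d1_a1 d2_a1 e2_a1 d2_c1 e2_c1 d2_a2 e1_a1 e2_a2 d1_c1 d2_c2] := core.
have [cVA | ncVA] := boolP (A \subset 'C(V)).
  have dvV : #|V| ^ 5 %| #|A <*> D|.
    apply: (trivial_action_card abV Vz ntz minV sDAV orb sVG der1A
      (y1 := d2) (y2 := e2) (y3 := d1) (y4 := e1)
      (x1 := c2) (x2 := a2) (x3 := c1) (x4 := a1)) => //; exact/and4P.
  have [V2 | V2] := eqVneq #|V| 2; first by rewrite V2 in dvV; rewrite dvV in n32.
  have V3 : 2 < #|V|.
    rewrite ltn_neqAle eq_sym V2 cardG_gt1; apply/trivgPn; exists z => //.
  have := dvdn_leq (cardG_gt0 _) dvV; rewrite leqNgt.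
  have : 3 ^ 5 <= #|V| ^ 5 by rewrite leq_exp2r.
  by move=> V5; rewrite (leq_trans leG) // (leq_trans _ V5).
have [x0 Ax0 mvx0] : exists2 x, x \in A & z ^ x != z.
  have /subsetPn[x Ax ncx] := ncVA; exists x => //.
  apply: contra ncx => /eqP.
  exact: (cent_fixA abV Vz ntz minV sDAV orb).
have VJ e : e \in D -> z ^ e \in V.
  by move=> De; rewrite memJ_norm ?(subsetP nVG) ?(subsetP sDG).
have mv_inv x : z ^ x != z -> z^-1 ^ x != z^-1.
  by rewrite conjVg (inj_eq invg_inj).
have mv_conj x e : x \in A -> e \in D -> z ^ x != z -> (z ^ e) ^ x != z ^ e.
  move=> Ax De; rewrite -(conj_swap abV minV sDAV Vz Ax De).
  by rewrite (inj_eq (@conjg_inj _ e)).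
(* This is [conj_commg] with [u = y ^ x * y^-1]; the last condition makes [x'] fix [u], either
   because [u = 1] or because [x'] centralises [V]. *)
have key x x' y v : x \in A -> x' \in A -> y \in D -> v \in V ->
    y ^ x' = v * y -> (y ^ x == y) || (x' \in 'C(V)) ->
    y ^ [~ x, x'] = (v ^ x)^-1 * v * y.
  move=> Ax Ax' Dy Vv yx' cond.
  have Vu : y ^ x * y^-1 \in V.
    have : [~ y^-1, x] \in V by rewrite (subsetP sDAV) ?mem_commg ?groupV.
    rewrite commgEl invgK conjVg -groupV invMg invgK.
    by [].
  apply: (conj_commg abV minV der1A Ax Ax' Vu Vv _ yx') => //; first by rewrite mulgKV.
  case/orP: cond => [/eqP -> | /centP cx']; first by rewrite mulgV conj1g.
  by apply/conjg_fixP/commgP/commute_sym/cx'.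
have mv x x' y v : x \in A -> x' \in A -> y \in D -> v \in V ->
    v ^ x != v -> y ^ x' = v * y -> (y ^ x == y) || (x' \in 'C(V)) ->
    y ^ [~ x, x'] != y.
  move=> Ax Ax' Dy Vv vx yx' cond; rewrite (key x x' y v) //.
  by rewrite mulg_neq // -eq_mulVg1.
have fx x x' y : x \in A -> x' \in A -> y \in D -> y ^ x' = y ->
    (y ^ x == y) || (x' \in 'C(V)) -> y ^ [~ x, x'] = y.
  move=> Ax Ax' Dy yx' cond; rewrite (key x x' y 1) ?mul1g //.
  by rewrite conj1g invg1 !mul1g.
have contra3 := nontrivial_action_false abV Vz ntz minV sDAV orb der1A leG.
have cent x : x \in A -> ~~ (z ^ x != z) -> x \in 'C(V).
  by move=> Ax; rewrite negbK => /eqP; apply: (cent_fixA abV Vz ntz minV sDAV orb).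
(* The first of [a1], [c1], [a2] that moves [z] supplies the commutators, with [x0] as the last
   resort. The elements already passed centralise [V], which stands in for the missing relations
   [y ^ x = y]. *)
have [mva1 | /(cent _ Aa1) cVa1] := boolP (z ^ a1 != z).
  apply: (contra3 a1 d2 e2 d1 [~ a1, c2] [~ a1, a2] [~ a1, c1]) => //.
  - exact/and3P.
  - by rewrite !mem_commg.
  - apply/and3P; split.
    + by apply: (mv _ _ _ (z ^ e2)); rewrite ?VJ ?mv_conj ?d2_a1 ?eqxx.
    + by apply: (mv _ _ _ z^-1); rewrite ?groupV ?mv_inv ?e2_a1 ?eqxx.
    + by apply: (mv _ _ _ (z ^ e1)); rewrite ?VJ ?mv_conj ?d1_a1 ?eqxx.
  - by rewrite fx ?d2_a1 ?eqxx.
  - by rewrite fx ?d2_a1 ?eqxx.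
  - by rewrite fx ?e2_a1 ?eqxx.
have [mvc1 | /(cent _ Ac1) cVc1] := boolP (z ^ c1 != z).
  apply: (contra3 c1 d2 e2 e1 [~ c1, c2] [~ c1, a2] [~ c1, a1]) => //.
  - exact/and3P.
  - by rewrite !mem_commg.
  - apply/and3P; split.
    + by apply: (mv _ _ _ (z ^ e2)); rewrite ?VJ ?mv_conj ?d2_c1 ?eqxx.
    + by apply: (mv _ _ _ z^-1); rewrite ?groupV ?mv_inv ?e2_c1 ?eqxx.
    + by apply: (mv _ _ _ z^-1); rewrite ?groupV ?mv_inv ?cVa1 ?orbT.
  - by rewrite fx ?d2_c1 ?eqxx.
  - by rewrite fx ?d2_c1 ?eqxx.
  - by rewrite fx ?e2_c1 ?eqxx.
have [mva2 | /(cent _ Aa2) cVa2] := boolP (z ^ a2 != z).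
  apply: (contra3 a2 d2 d1 e1 [~ a2, c2] [~ a2, c1] [~ a2, a1]) => //.
  - exact/and3P.
  - by rewrite !mem_commg.
  - apply/and3P; split.
    + by apply: (mv _ _ _ (z ^ e2)); rewrite ?VJ ?mv_conj ?d2_a2 ?eqxx.
    + by apply: (mv _ _ _ (z ^ e1)); rewrite ?VJ ?mv_conj ?cVc1 ?orbT.
    + by apply: (mv _ _ _ z^-1); rewrite ?groupV ?mv_inv ?cVa1 ?orbT.
  - by rewrite fx ?d2_a2 ?eqxx.
  - by rewrite fx ?d2_a2 ?eqxx.
  - by rewrite fx ?cVa1 ?orbT.
apply: (contra3 x0 e2 d1 e1 [~ x0, a2] [~ x0, c1] [~ x0, a1]) => //.
- exact/and3P.
- by rewrite !mem_commg.
- apply/and3P; split.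
  + by apply: (mv _ _ _ z^-1); rewrite ?groupV ?mv_inv ?cVa2 ?orbT.
  + by apply: (mv _ _ _ (z ^ e1)); rewrite ?VJ ?mv_conj ?cVc1 ?orbT.
  + by apply: (mv _ _ _ z^-1); rewrite ?groupV ?mv_inv ?cVa1 ?orbT.
- by rewrite fx ?cVc1 ?orbT.
- by rewrite fx ?cVa1 ?orbT.
- by rewrite fx ?cVa1 ?orbT.
Qed.

(* Modulo a normal subgroup that is maximal among those avoiding [z], the normal
   closure of [z] is the unique minimal normal subgroup. *)
Lemma action_core_false (gT : finGroupType) (A D : {group gT})
    (S T : {set gT}) (a1 c1 a2 c2 d1 e1 d2 e2 z : gT) :
    A :=: <<S>> -> D :=: <<T>> ->
    [set a1; c1; a2; c2] \subset A -> [set d1; e1; d2; e2] \subset D ->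
    action_core a1 c1 a2 c2 d1 e1 d2 e2 z ->
    (forall x, x \in S -> exists2 y, y \in D & z ^ x = z ^ y) ->
    (forall y, y \in T -> exists2 x, x \in A & z ^ y = z ^ x) ->
    [~: D, A] \subset <<z ^: (A <*> D)>> -> z \in A <*> D -> z != 1 ->
    #|A <*> D| < 64 -> ~~ (32 %| #|A <*> D|) ->
  False.
Proof.
pose H := (A <*> D)%G; rewrite -[A <*> D]/(gval H).
move=> defA defD sA sD core conjS conjT sDAZ Hz ntz leH n32.
have [sAH sDH] : A \subset H /\ D \subset H by rewrite joing_subl joing_subr.
have [|N maxN] := @ex_maxgroup _ (fun N : {group gT} => (N <| H) && (z \notin N)).
  by exists 1%G; rewrite normal1 inE.
have [/andP[nNH ncz] maxN'] := maxgroupP maxN.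
have nHN := normal_norm nNH.
have [nAN nDN] := (subset_trans sAH nHN, subset_trans sDH nHN).
have nz := subsetP nHN z Hz.
pose q := coset_morphism N.
have defH : (A / N) <*> (D / N) = H / N by rewrite -quotientY.
pose V := <<q z ^: (H / N)>>%G.
have Vz : q z \in V by rewrite mem_gen ?class_refl.
have ntqz : q z != 1.
  by apply: contra ncz => /eqP /coset_idr; apply.
have sVH : V \subset H / N.
  rewrite gen_subG; apply/subsetP=> _ /imsetP[x Hx ->].
  by rewrite groupJ // mem_quotient.
have nVH : H / N \subset 'N(V) by rewrite norms_gen ?class_norm.
have minV : minnormal V ((A / N) <*> (D / N)).
  rewrite defH; apply/mingroupP; split=> [|W /andP[ntW nWH] sWV].
    by rewrite nVH andbT; apply/trivgPn; exists (q z).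
  have nWH' : W <| H / N by rewrite /normal nWH (subset_trans sWV).
  have [M defW sNM nMH] := inv_quotientN nNH nWH'.
  apply/eqP; rewrite eqEsubset sWV gen_subG /=.
  (* If [z] avoided the preimage [M] of [W], maximality of [N] would give [M = N] and [W]
     trivial. *)
  suff Wz : q z \in W.
    by apply/subsetP=> _ /imsetP[x Hx ->]; rewrite memJ_norm // (subsetP nWH).
  rewrite defW mem_quotient //; apply: contraNT ntW => ncMz.
  by rewrite defW (maxN' M) ?nMH // trivg_quotient.
have sDAV : [~: D / N, A / N] \subset V.
  rewrite -quotientR // (subset_trans (quotientS N sDAZ)) //.
  rewrite quotient_gen ?quotient_class //.
  by apply: subset_trans nHN; apply/class_subG.
have sAN x : x \in A -> q x \in A / N by apply: mem_quotient.
have sDN x : x \in D -> q x \in D / N by apply: mem_quotient.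
have [Aa1 Ac1 Aa2 Ac2] : [/\ a1 \in A, c1 \in A, a2 \in A & c2 \in A].
  by move: sA; rewrite !subUset !sub1set -!andbA => /and4P.
have [Dd1 De1 Dd2 De2] : [/\ d1 \in D, e1 \in D, d2 \in D & e2 \in D].
  by move: sD; rewrite !subUset !sub1set -!andbA => /and4P.
have qJ x y : x \in 'N(N) -> y \in 'N(N) -> q (x ^ y) = q x ^ q y.
  exact: (morphJ q).
apply: (minnormal_action_core_false (A := (A / N)%G) (D := (D / N)%G) (V := V)
  (S := S / N) (T := T / N) (a1 := q a1) (c1 := q c1) (a2 := q a2) (c2 := q c2)
  (d1 := q d1) (e1 := q e1) (d2 := q d2) (e2 := q e2) (z := q z)) => //.
- by rewrite /= defA quotient_gen // (subset_trans _ nAN) // defA subset_gen.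
- by rewrite /= defD quotient_gen // (subset_trans _ nDN) // defD subset_gen.
- by rewrite !subUset !sub1set !sAN.
- by rewrite !subUset !sub1set !sDN.
- apply: (morph_action_core (G := 'N(N)%G)) => //.
  by rewrite !subUset !sub1set nz !(subsetP nAN a1, subsetP nAN c1,
    subsetP nAN a2, subsetP nAN c2, subsetP nDN d1, subsetP nDN e1,
    subsetP nDN d2, subsetP nDN e2).
- move=> _ /morphimP[x Nx Sx ->]; have [y Dy eqxy] := conjS x Sx.
  by exists (q y); rewrite ?sDN // -!qJ ?eqxy // (subsetP nDN).
- move=> _ /morphimP[x Nx Sx ->]; have [y Dy eqxy] := conjT x Sx.
  by exists (q y); rewrite ?sAN // -!qJ ?eqxy // (subsetP nAN).
- by rewrite /= defH (leq_ltn_trans _ leH) ?leq_quotient.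
by rewrite /= defH; apply: contra n32 => /dvdn_trans; apply; apply: dvdn_quotient.
Qed.

(** * From a diagonal double Kodaira structure to the reduced relations *)

Lemma conj_kcomm (gT : finGroupType) (x y : gT) : y ^ x^-1 = kcomm x y * y.
Proof. by rewrite /kcomm mulgKV conjgE invgK !mulgA. Qed.

(** Every right-hand side is a product of conjugates of [z] and [z^-1] under elements normalising
    [Z]. *)
Lemma ddk_commg_mem (gT : finGroupType) (b : nat) (S : ddk_tuple gT b)
    (Z : {group gT}) :
    action_r1_relations S -> action_t1_relations S -> z S \in Z ->
    (forall j, [&& r2 S j \in 'N(Z) & t2 S j \in 'N(Z)]) ->
  forall j k, [/\ kcomm (r1 S j) (r2 S k) \in Z, kcomm (r1 S j) (t2 S k) \in Z,
                  kcomm (t1 S j) (r2 S k) \in Z & kcomm (t1 S j) (t2 S k) \in Z].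
Proof.
move=> actr actt Zz nZ j k.
have nr i : r2 S i \in 'N(Z) by case/andP: (nZ i).
have nt i : t2 S i \in 'N(Z) by case/andP: (nZ i).
have memJ x u : x \in Z -> u \in 'N(Z) -> u^-1 * x * u \in Z.
  by move=> Zx nu; rewrite -mulgA -conjgE memJ_norm.
have memJV x u : x \in Z -> u \in 'N(Z) -> u * x * u^-1 \in Z.
  by move=> Zx nu; rewrite -{1}[u]invgK memJ ?groupV.
have Zl x u : x \in Z -> u \in 'N(Z) -> kcomm x u \in Z.
  by move=> Zx nu; rewrite /kcomm -!mulgA groupM // !mulgA memJV ?groupV.
have Zr x u : x \in Z -> u \in 'N(Z) -> kcomm u x \in Z.
  by move=> Zx nu; rewrite /kcomm groupMr ?groupV // memJV.
have [ltjk | gtjk | /val_inj eqjk] := ltngtP j k.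
- by rewrite (r1_r2_lt actr) // (r1_t2_lt actr) // (t1_r2_lt actt) // (t1_t2_lt actt).
- rewrite (r1_r2_gt actr) // (r1_t2_gt actr) // (t1_r2_gt actt) // (t1_t2_gt actt) //.
  split; try by [apply: Zl; rewrite ?groupV | apply: Zr; rewrite ?groupV].
    rewrite -!mulgA groupM ?groupV // !mulgA.
    have := memJV _ _ (memJ _ _ Zz (nr j)) (nr k).
    by rewrite !mulgA.
  (* With [w = z ^ t2 j], the expression is [w * z^-1] times the conjugate of [z * w^-1] by
     [(t2 k)^-1]. *)
  have Zze := memJ _ _ Zz (nt j); rewrite -!mulgA.
  have := groupM (groupM Zze (groupVr Zz)) (memJV _ _ (groupM Zz (groupVr Zze)) (nt k)).
  by rewrite !invMg !invgK !mulgA.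
- rewrite eqjk (r1_r2_eq actr) (r1_t2_eq actr) (t1_r2_eq actt) (t1_t2_eq actt).
  by split; rewrite ?group1 ?groupV // ?memJ // Zr ?groupV.
Qed.

Theorem proposition3p7 (gT : finGroupType) (G : {group gT})
    (hG : 33 <= #|G| <= 63) (b n : nat) (hb : 2 <= b) (hn : 2 <= n) :
  ~ admits_ddks G b n.
Proof.
case=> S [_ _ genS ordz _ actr actt].
(* Inverses enter because [y ^ x] is [x^-1 * y * x], while the relations describe [x * y * x^-1]. *)
pose SA := [set (r1 S j)^-1 | j : 'I_b] :|: [set (t1 S j)^-1 | j : 'I_b].
pose TD := [set r2 S j | j : 'I_b] :|: [set t2 S j | j : 'I_b].
pose A := <<SA>>%G; pose D := <<TD>>%G; pose H := (A <*> D)%G.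
have Ar j : (r1 S j)^-1 \in A.
  by rewrite mem_gen // inE; apply/orP; left; apply/imsetP; exists j.
have At j : (t1 S j)^-1 \in A.
  by rewrite mem_gen // inE; apply/orP; right; apply/imsetP; exists j.
have Dr j : r2 S j \in D.
  by rewrite mem_gen // inE; apply/orP; left; apply/imsetP; exists j.
have Dt j : t2 S j \in D.
  by rewrite mem_gen // inE; apply/orP; right; apply/imsetP; exists j.
have sEG x : x \in ddk_elements S -> x \in G by rewrite -genS; apply: mem_gen.
have sHG : H \subset G.
  rewrite join_subG !gen_subG !subUset.
  apply/andP; split; apply/andP; split; apply/subsetP=> _ /imsetP[j _ ->];
    rewrite ?groupV sEG // !inE; by rewrite imset_f ?orbT.
have sAH : {subset A <= H} := subsetP (joing_subl A D).
have sDH : {subset D <= H} := subsetP (joing_subr A D).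
pose i0 : 'I_b := Ordinal (ltnW hb); pose i1 : 'I_b := Ordinal hb.
(* Each generator of [A] is matched with a generator of [D] having the same effect on [z], which
   gives both orbit hypotheses of [action_core_false]. *)
have zr j : z S ^ (r1 S j)^-1 = z S ^ r2 S j.
  by rewrite conj_kcomm (r1_z actr) -conj_kcomm invgK.
have zt j : z S ^ (t1 S j)^-1 = z S ^ t2 S j.
  by rewrite conj_kcomm (t1_z actt) -conj_kcomm invgK.
have Hz : z S \in H.
  rewrite -groupV -(r1_t2_eq actr i0) -[kcomm _ _](mulgK (t2 S i0)) -conj_kcomm.
  have [Hr Ht] : (r1 S i0)^-1 \in H /\ t2 S i0 \in H by split; [apply: sAH | apply: sDH].
  by rewrite groupMr ?groupV // groupJ.
have ntz : z S != 1 by rewrite -order_eq1 ordz; case: n hn {ordz} => [|[]].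
have leH := subset_leq_card sHG; have [gt32 le63] := andP hG.
apply (@action_core_false _ A D SA TD (r1 S i0)^-1 (t1 S i0)^-1 (r1 S i1)^-1
  (t1 S i1)^-1 (r2 S i0) (t2 S i0) (r2 S i1) (t2 S i1) (z S)) => //.
- by rewrite !subUset !sub1set !Ar !At.
- by rewrite !subUset !sub1set !Dr !Dt.
- split; rewrite conj_kcomm.
  + by rewrite (r1_r2_eq actr) mul1g.
  + by rewrite (r1_r2_lt actr) ?mul1g.
  + by rewrite (r1_t2_lt actr) ?mul1g.
  + by rewrite (t1_r2_lt actt) ?mul1g.
  + by rewrite (t1_t2_lt actt) ?mul1g.
  + by rewrite (r1_r2_eq actr) mul1g.
  + by rewrite (r1_t2_eq actr).
  + by rewrite (r1_t2_eq actr).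
  + by rewrite (t1_r2_eq actt) conjgE mulgA.
  + by rewrite (t1_r2_eq actt) conjgE mulgA.
- by move=> _ /setUP[] /imsetP[j _ ->]; [exists (r2 S j) | exists (t2 S j)].
- by move=> _ /setUP[] /imsetP[j _ ->]; [exists (r1 S j)^-1 | exists (t1 S j)^-1].
- pose Z := <<z S ^: H>>%G.
  have nZH : H \subset 'N(Z) by rewrite norms_gen ?class_norm.
  have nZA : A \subset 'N(Z) := subset_trans (joing_subl A D) nZH.
  have nZD : D \subset 'N(Z) := subset_trans (joing_subr A D) nZH.
  have Zz : z S \in Z by rewrite mem_gen ?class_refl.
  have nZ j : [&& r2 S j \in 'N(Z) & t2 S j \in 'N(Z)].
    by rewrite !(subsetP nZD).
  have kcommV x y : kcomm x y \in Z -> y \in 'N(Z) -> [~ y, x^-1] \in Z.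
    by move=> Zk ny; rewrite commgEl conj_kcomm -conjgE memJ_norm.
  apply: (@commg_gen_subset _ TD SA Z) => // y x.
  have Zk j k := ddk_commg_mem actr actt Zz nZ j k.
  move=> /setUP[] /imsetP[k _ ->] /setUP[] /imsetP[j _ ->];
    by apply: kcommV; [case: (Zk j k) | case/andP: (nZ k)].
- exact: leq_trans leH le63.
(* Then 32 would divide [#|G|], but no multiple of 32 lies strictly between 32 and 64. *)
apply: contraL gt32 => d32; have := dvdn_trans d32 (cardSg sHG).
rewrite -leqNgt; case/dvdnP=> k kE; move: le63; rewrite kE.
by case: k {kE} => [|[|k]] //; lia.
Qed.
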